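(* Let $G$ be a finite group, $m\ge1$ an integer, and $f_1,\ldots,f_{m+1}:G\to\mathbb{C}$ functions. Then $$\mathbb{E}_{\sigma_1,\ldots,\sigma_m\sim G}\left\|f_1^{\sigma_1}*f_2^{\sigma_2}*\cdots*f_m^{\sigma_m}*f_{m+1}\right\|_2^2=\sum_{\chi\in\hat{G}}\frac{\prod_{i=1}^{m+1}\|f_i^{=\chi}\|_2^2}{\chi(1)^{2m}}.$$
   Context: $\mathbb{E}_{\sigma_1,\dots,\sigma_m\sim G}$ is the average over independent uniformly random $\sigma_1,\dots,\sigma_m\in G$. For $f\in\mathbb{C}[G]$ and $\sigma\in G$, $f^{\sigma}(\tau)=f(\tau\sigma)$. Convolution is $f*g(x)=\frac{1}{|G|}\sum_{y\in G}f(y)g(y^{-1}x)$. The inner product is $\langle f,g\rangle=\frac{1}{|G|}\sum_{\sigma\in G}f(\sigma)\overline{g(\sigma)}$ and $\|f\|_2^2=\langle f,f\rangle$. $\hat{G}$ is the set of irreducible complex characters of $G$. If $(V,\rho)$ is an irreducible representation with character $\chi$, $W_\chi\subseteq\mathbb{C}[G]$ is the span of the functions $\sigma\mapsto\varphi(\rho(\sigma)v)$ with $v\in V$, $\varphi\in V^*$; $\mathbb{C}[G]$ is the orthogonal direct sum of the $W_\chi$, and $f^{=\chi}$ is the orthogonal projection of $f$ onto $W_\chi$. *)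

(* Defs.v *)
From mathcomp Require Import all_boot all_order all_algebra all_fingroup.
From mathcomp Require Import mxrepresentation.
From mathcomp Require Import boolp classical_sets fsbigop reals.
From mathcomp Require Import complex.

Set Implicit Arguments.
Unset Strict Implicit.
Unset Printing Implicit Defensive.

Import Order.TTheory GRing.Theory Num.Theory.
Local Open Scope classical_set_scope.
Local Open Scope complex_scope.
Local Open Scope ring_scope.

Section GroupAlgebra.
Variables (R : realType) (gT : finGroupType).
Implicit Types (f g : {ffun gT -> R[i]}) (chi : {ffun gT -> R[i]}).

Definition expectation (T : finType) (F : T -> R[i]) : R[i] :=
  (#|T|%:R)^-1 * \sum_(t : T) F t.

Definition translate (s : gT) f : {ffun gT -> R[i]} :=
  [ffun t => f (t * s)%g].

Definition conv f g : {ffun gT -> R[i]} :=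
  [ffun x => (#|gT|%:R)^-1 * \sum_(y : gT) f y * g (y^-1 * x)%g].

Definition inner f g : R[i] :=
  (#|gT|%:R)^-1 * \sum_(x : gT) f x * (g x)^*%R.

Definition normsq f : R[i] := inner f f.

Definition rep_char n (rho : mx_representation R[i] [set: gT]%G n) :
  {ffun gT -> R[i]} := [ffun x => \tr (rho x)].

(* [mx_irreducible] refers to the action on row vectors; rho is irreducible on
   rows iff it is irreducible on columns (the two actions are dual). *)
Definition irr_char : set {ffun gT -> R[i]} :=
  [set chi | exists n (rho : mx_representation R[i] [set: gT]%G n),
     mx_irreducible rho /\ rep_char rho = chi].

(* [rho x] acts on column vectors [v : 'cV_n]; row vectors [phi : 'rV_n] are
   the linear forms [v |-> phi *m v]. *)
Definition matrix_coef n (rho : mx_representation R[i] [set: gT]%G n)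
    (v : 'cV[R[i]]_n) (phi : 'rV[R[i]]_n) : {ffun gT -> R[i]} :=
  [ffun x => (phi *m (rho x *m v)) 0 0].

(* All matrix coefficients of all irreducible representations with character
   chi; a single representation already gives the same set, since these
   representations are isomorphic. *)
Definition matrix_coefs chi : set {ffun gT -> R[i]} :=
  [set f | exists n (rho : mx_representation R[i] [set: gT]%G n)
                  (v : 'cV[R[i]]_n) (phi : 'rV[R[i]]_n),
     [/\ mx_irreducible rho, rep_char rho = chi & f = matrix_coef rho v phi]].

Definition lin_span (S : set {ffun gT -> R[i]}) : set {ffun gT -> R[i]} :=
  [set f | exists k (a : 'I_k -> R[i]) (g : 'I_k -> {ffun gT -> R[i]}),
     (forall j, S (g j)) /\ f = [ffun x => \sum_(j < k) a j * g j x]].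

Definition isotypic chi : set {ffun gT -> R[i]} := lin_span (matrix_coefs chi).

Definition is_ortho_proj (W : set {ffun gT -> R[i]}) f g : Prop :=
  W g /\ (forall h, W h -> inner (f - g) h = 0).

(* The orthogonal projection onto W: the default 0 is never used when W is a
   linear subspace, as the projection then exists and is unique. *)
Definition ortho_proj (W : set {ffun gT -> R[i]}) f : {ffun gT -> R[i]} :=
  xget 0 (is_ortho_proj W f).

Definition chi_part chi f : {ffun gT -> R[i]} := ortho_proj (isotypic chi) f.

(* f_1^{s_1} * (f_2^{s_2} * (... * (f_m^{s_m} * f_{m+1}))); indices start at 0,
   so f_{m+1} is [f ord_max]. *)
Definition twisted_conv m (f : 'I_m.+1 -> {ffun gT -> R[i]})
    (s : {ffun 'I_m -> gT}) : {ffun gT -> R[i]} :=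
  foldr conv (f ord_max)
    [seq translate (s i) (f (widen_ord (leqnSn m) i)) | i <- enum 'I_m].

End GroupAlgebra.

(* Main.v *)
From HB Require Import structures.
Require Import Defs.
From mathcomp Require Import all_boot all_order all_algebra all_fingroup.
From mathcomp Require Import cyclic pgroup separable cyclotomic.
From mathcomp Require Import mxpoly mxrepresentation.
From mathcomp Require Import boolp classical_sets fsbigop reals.
From mathcomp Require Import complex ring.

Set Implicit Arguments.
Unset Strict Implicit.
Unset Printing Implicit Defensive.

Import Order.TTheory GRing.Theory Num.Theory.
Local Open Scope complex_scope.
Local Open Scope ring_scope.

(** Write [P_chi f = chi(1) chi * f]. Schur orthogonality makes convolution with
    [chi(1) chi] the identity on [W_chi] and zero on the other [W_chi'], and
    [chi (x^-1)] being the conjugate of [chi x] makes it self-adjoint; so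
    [P_chi] is the orthogonal projection onto [W_chi] ([chi_partE]). Maschke's
    theorem for the regular representation writes every function as a sum of
    matrix coefficients of irreducible representations. Hence there are finitely
    many irreducible characters, the [P_chi] add up to the identity
    ([irr_char_complete]), and squared norms split over them ([parseval]).

    Since [chi] is a class function, [P_chi (f^s * g) = f^s * P_chi g], which
    reduces the theorem to the average of [||f^s * g||^2] over [s] for [g] in
    [W_chi] ([expectation_conv]). In what follows powers of [|G|] are left out.
    Expanding the square, the average over [s] replaces the [f]-factors by the
    autocorrelation
    [A w = \sum_s f s (f (w s))^*], where [w] is the quotient of the two
    convolution variables; what remains of the [g]-factors is averaged over the
    conjugates of [w]. By Schur's lemma, averaging an element of [W_chi] over
    conjugates multiplies it by [chi w / chi(1)], so the [g]-factors contribute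
    [||g||^2 chi w / chi(1)]. Summing [A w] against [chi w] is another
    convolution of [f] with [chi], giving [||P_chi f||^2 / chi(1)]. Each of the
    [m] convolutions therefore contributes one factor
    [||P_chi f_i||^2 / chi(1)^2], which is the induction of
    [expectation_twisted_proj]. *)

(** * Schur orthogonality for matrices *)

Section Schur.
Variables (C : numClosedFieldType) (gT : finGroupType).
Local Notation repr n := (mx_representation C [set: gT]%G n).
Local Notation nG := (#|gT|%:R : C).

Lemma card_neq0 : nG != 0.
Proof. by rewrite pnatr_eq0 -lt0n -cardsT cardG_gt0. Qed.

Lemma reprM n (rho : repr n) x y : rho (x * y)%g = rho x *m rho y.
Proof. by rewrite repr_mxM ?inE. Qed.

Lemma reprVK n (rho : repr n) x : rho x^-1%g *m rho x = 1%:M.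
Proof. by rewrite -reprM mulVg repr_mx1. Qed.

Lemma repr_exp n (rho : repr n.+1) x k : rho (x ^+ k)%g = rho x ^+ k.
Proof.
by elim: k => [|k IHk]; rewrite ?repr_mx1 // expgS reprM IHk exprS.
Qed.

(** As [rho x] has finite order, its minimal polynomial divides [X^N - 1], which
    has simple roots; so [rho x] is diagonalizable with eigenvalues of modulus
    one, and inverting these is conjugating them. *)
Lemma tr_reprV n (rho : repr n) x : \tr (rho x^-1%g) = ((\tr (rho x))^*)%R.
Proof.
case: n rho => [|n] rho; first by rewrite /mxtrace !big_ord0 rmorph0.
have rhoX : rho x ^+ #|gT| = 1.
  by rewrite -repr_exp -cardsT expg_cardG ?inE ?repr_mx1.
have [P Pu /(diagonalizable_forLR Pu)[d rhod]] : exists2 P, P \in unitmx &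
    similar_diag P (rho x).
  apply/diagonalizableP.
  have [rs ers] := closed_field_poly_normal ('X^#|gT| - 1 : {poly C}).
  have gT0 : (0 < #|gT|)%N by rewrite -cardsT cardG_gt0.
  rewrite lead_coefXnsubC // scale1r in ers.
  exists rs.
    by rewrite -separable_prod_XsubC -ers separable_Xn_sub_1 // card_neq0.
  rewrite -ers mxminpoly_min // rmorphB rmorphXn /= horner_mx_X rhoX.
  by rewrite rmorph1 subrr.
rewrite conjVmx // in rhod.
have PV : invmx P *m P = 1%:M by rewrite mulVmx.
have conjM A B : (invmx P *m A *m P) *m (invmx P *m B *m P)
    = invmx P *m (A *m B) *m P.
  by rewrite !mulmxA mulmxK.
have conjX k : (invmx P *m diag_mx d *m P) ^+ k
    = invmx P *m diag_mx (\row_i d 0 i ^+ k) *m P.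
  elim: k => [|k IHk].
    rewrite (_ : \row_i _ = const_mx 1).
      by rewrite diag_const_mx mulmx1 PV.
    by apply/rowP => i; rewrite !mxE.
  rewrite exprS IHk -mulmxE conjM mulmx_diag; congr (_ *m diag_mx _ *m _).
  by apply/rowP => i; rewrite !mxE exprS.
have d1 i : `|d 0 i| = 1.
  have : (diag_mx (\row_i d 0 i ^+ #|gT|)) = 1%:M.
    have := rhoX; rewrite rhod conjX => /(congr1 (fun A => P *m A *m invmx P)).
    by rewrite !mulmxA mulmxV // mul1mx mulmxK // mulmx1 mulmxV.
  move/matrixP/(_ i i); rewrite !mxE eqxx !mulr1n => di1.
  apply/eqP; rewrite -(@pexpr_eq1 _ _ #|gT|) //; last by rewrite -cardsT cardG_gt0.
  by rewrite -normrX di1 normr1.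
have rhoV : rho x^-1%g = invmx P *m diag_mx (map_mx Num.conj d) *m P.
  have rhou : rho x \in unitmx by apply: repr_mx_unit; rewrite inE.
  rewrite repr_mxV ?inE // -[RHS]mulmx1 -(mulmxV rhou) mulmxA.
  rewrite {2}rhod conjM mulmx_diag (_ : \row_i _ = const_mx 1).
    by rewrite diag_const_mx mulmx1 PV mul1mx.
  by apply/rowP => i; rewrite !mxE mulrC -normCK d1 expr1n.
rewrite rhoV [in RHS]rhod ![\tr (_ *m _ *m P)]mxtrace_mulC !mulmxA mulmxV //.
rewrite !mul1mx !mxtrace_diag rmorph_sum.
by apply: eq_bigr => i _; rewrite mxE.
Qed.

Lemma sum_intertwine n1 n2 (rho1 : repr n1) (rho2 : repr n2) X z :
  rho1 z *m (\sum_y rho1 y *m X *m rho2 y^-1%g) =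
  (\sum_y rho1 y *m X *m rho2 y^-1%g) *m rho2 z.
Proof.
rewrite mulmx_sumr mulmx_suml [RHS](reindex_inj (mulgI z)).
apply: eq_bigr => y _.
by rewrite reprM invMg reprM -!mulmxA reprVK mulmx1.
Qed.

(** Schur's lemma for two representations: the kernel and the image of [T] are
    submodules, so a nonzero [T] is an isomorphism. *)
Lemma intertwine_tr_eq n1 n2 (rho1 : repr n1) (rho2 : repr n2) T :
  mx_irreducible rho1 -> mx_irreducible rho2 -> T != 0 ->
  (forall z, rho1 z *m T = T *m rho2 z) -> forall x, \tr (rho1 x) = \tr (rho2 x).
Proof.
case/mx_irrP=> n1_gt0 irr1 /mx_irrP[n2_gt0 irr2] T0 homT x.
have freeT : row_free T.
  rewrite -kermx_eq0; apply: contraR T0 => ker0.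
  suff : row_full (kermx T).
    by rewrite -sub1mx => /sub_kermxP; rewrite mul1mx => ->.
  apply: irr1 ker0; apply/mxmoduleP => y _.
  by apply/sub_kermxP; rewrite -mulmxA homT mulmxA mulmx_ker mul0mx.
have fullT : row_full T.
  suff: row_full <<T>>%MS by rewrite -!sub1mx genmxE.
  apply: irr2; last by rewrite (eqmx_eq0 (genmxE _)).
  apply/mxmoduleP => y _; rewrite genmxE (eqmxMr _ (genmxE _)) -homT.
  exact: submxMl.
have rs : mx_rsim rho1 rho2.
  apply: (MxReprSim _ freeT) => //.
  exact: etrans (esym (eqP freeT)) (eqP fullT).
have [B [B' BB ->]] := mx_rsim_def rs; last by rewrite inE.
by rewrite mxtrace_mulC mulmxA BB mul1mx.
Qed.

(** The left-hand side commutes with [rho], so it is scalar by Schur's lemma over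
    a closed field; the trace determines the scalar. *)
Lemma sum_conj_scalar n (rho : repr n) X : mx_irreducible rho ->
  \sum_y rho y *m X *m rho y^-1%g = (nG * \tr X / n%:R)%:M.
Proof.
move=> irr; set T := (LHS).
have absr := group_closure_closed_field irr.
have /is_scalar_mxP[a Ta] : is_scalar_mx T.
  apply: (mx_abs_irr_cent_scalar absr); apply/centgmxP => z _.
  by rewrite sum_intertwine.
have n0 : n%:R != 0 :> C.
  by rewrite pnatr_eq0 -lt0n; case/mx_irrP: irr.
rewrite Ta; congr (_%:M); apply: (mulIf n0); rewrite divfK //.
rewrite mulr_natr -mxtrace_scalar -Ta /T raddf_sum /=.
under eq_bigr do rewrite mxtrace_mulC mulmxA reprVK mul1mx.
by rewrite sumr_const mulr_natl.
Qed.

(** Expanding the trace turns a character sum into sums of the form treated in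
    [sum_intertwine], with the matrix units [delta_mx i k] in the middle. *)
Lemma sum_char_repr_entry n1 n2 (rho1 : repr n1) (rho2 : repr n2) k l :
  (\sum_y \tr (rho1 y) *: rho2 y^-1%g) k l =
  \sum_i (\sum_y rho1 y *m delta_mx i k *m rho2 y^-1%g) i l.
Proof.
under [RHS]eq_bigr do rewrite summxE.
rewrite summxE exchange_big; apply: eq_bigr => y _.
rewrite mxE mulr_suml; apply: eq_bigr => i _.
rewrite mxE (bigD1 k) //= big1 ?addr0 => [|j jk].
  rewrite mxE (bigD1 i) //= big1 ?addr0 => [|j ji]; first by rewrite mxE !eqxx mulr1.
  by rewrite mxE (negPf ji) mulr0.
rewrite mxE big1 ?mul0r // => j' _.
by rewrite mxE (negPf jk) andbF mulr0.
Qed.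

Lemma sum_char_repr n (rho : repr n) : mx_irreducible rho ->
  \sum_y \tr (rho y) *: rho y^-1%g = (nG / n%:R)%:M.
Proof.
move=> irr; apply/matrixP => k l; rewrite sum_char_repr_entry.
under eq_bigr => i _ do rewrite sum_conj_scalar // mxE.
rewrite (bigD1 l) //= big1 ?addr0 => [|i il]; last by rewrite (negPf il).
rewrite eqxx mulr1n [RHS]mxE /mxtrace (bigD1 k) //= big1 ?addr0 => [|j jk].
  by rewrite mxE eqxx /=; case: (k == l); rewrite ?mulr1 // mulr0 mul0r.
by rewrite mxE (negPf jk) andbF.
Qed.

Lemma sum_char_repr_neq n1 n2 (rho1 : repr n1) (rho2 : repr n2) :
  mx_irreducible rho1 -> mx_irreducible rho2 ->
  (exists x, \tr (rho1 x) != \tr (rho2 x)) ->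
  \sum_y \tr (rho1 y) *: rho2 y^-1%g = 0.
Proof.
move=> irr1 irr2 [x neq]; apply/matrixP => k l; rewrite sum_char_repr_entry mxE.
apply: big1 => i _; set T : 'M_(n1, n2) := (\sum_y _).
have [->|T0] := eqVneq T 0; first by rewrite mxE.
case/eqP: neq; apply: (intertwine_tr_eq irr1 irr2 T0) => z.
exact: sum_intertwine.
Qed.

Lemma sum_repr_conj n (rho : repr n) w : mx_irreducible rho ->
  \sum_y rho (y^-1 * w * y)%g = (nG * \tr (rho w) / n%:R)%:M.
Proof.
move=> irr; rewrite -(sum_conj_scalar _ irr) [RHS](reindex_inj invg_inj).
by apply: eq_bigr => y _; rewrite invgK !reprM.
Qed.

End Schur.

(** * The projections onto the isotypic components *)

Section Isotypic.
Variables (R : realType) (gT : finGroupType).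
Local Notation C := R[i].
Local Notation nG := (#|gT|%:R : C).
Local Notation repr n := (mx_representation R[i] [set: gT]%G n).
Implicit Types (f g h chi : {ffun gT -> C}).

(** Convolution with the central idempotent [chi(1) chi]. *)
Definition central_proj chi f : {ffun gT -> C} :=
  [ffun x => chi 1%g / nG * \sum_y chi y * f (y^-1 * x)%g].

(** Moves a sum over the group inside a matrix coefficient, so that the
    identities between sums of matrices above apply to functions in [W_chi]. *)
Lemma mulmx_coef_sum n (phi : 'rV[C]_n) (v : 'cV[C]_n)
    (a : gT -> C) (M : gT -> 'M[C]_n) :
  (phi *m ((\sum_y a y *: M y) *m v)) 0 0 =
  \sum_y a y * (phi *m (M y *m v)) 0 0.
Proof.
rewrite mulmx_suml mulmx_sumr summxE; apply: eq_bigr => y _.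
by rewrite -scalemxAl -scalemxAr mxE.
Qed.

Lemma irr_char1 chi : irr_char chi -> chi 1%g != 0.
Proof.
case=> n [rho [/mx_irrP[n0 _] <-]]; rewrite ffunE repr_mx1 mxtrace1.
by rewrite pnatr_eq0 -lt0n.
Qed.

Lemma irr_char1_conj chi : irr_char chi -> ((chi 1%g)^*)%R = chi 1%g.
Proof. by case=> n [rho [_ <-]]; rewrite ffunE repr_mx1 mxtrace1 conjC_nat. Qed.

Lemma irr_charV chi x : irr_char chi -> chi x^-1%g = ((chi x)^*)%R.
Proof. by case=> n [rho [_ <-]]; rewrite !ffunE tr_reprV. Qed.

Lemma irr_charC chi x y : irr_char chi -> chi (x * y)%g = chi (y * x)%g.
Proof. by case=> n [rho [_ <-]]; rewrite !ffunE !reprM mxtrace_mulC. Qed.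

Lemma central_proj_sum chi k (a : 'I_k -> C) (g : 'I_k -> {ffun gT -> C}) x :
  central_proj chi [ffun x => \sum_j a j * g j x] x =
  \sum_j a j * central_proj chi (g j) x.
Proof.
rewrite ffunE; under eq_bigr do rewrite ffunE mulr_sumr.
rewrite exchange_big mulr_sumr; apply: eq_bigr => j _.
rewrite ffunE mulrCA; congr (_ * _); rewrite mulr_sumr.
by apply: eq_bigr => y _; rewrite mulrCA.
Qed.

Lemma central_proj_coef n1 n2 (rho1 : repr n1) (rho2 : repr n2) v phi x :
  central_proj (rep_char rho1) (matrix_coef rho2 v phi) x = n1%:R / nG *
   (phi *m ((\sum_y \tr (rho1 y) *: rho2 y^-1%g) *m (rho2 x *m v))) 0 0.
Proof.
rewrite !ffunE repr_mx1 mxtrace1 mulmx_coef_sum; congr (_ * _).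
by apply: eq_bigr => y _; rewrite !ffunE reprM -!mulmxA.
Qed.

Lemma central_proj_id chi g : isotypic chi g -> central_proj chi g = g.
Proof.
case=> k [a [e [coefe ->]]]; apply/ffunP => x.
rewrite central_proj_sum ffunE; apply: eq_bigr => j _; congr (_ * _).
have [n [rho [v [phi [irr <- ->]]]]] := coefe j.
have n0 : n%:R != 0 :> C by case/mx_irrP: irr => n0 _; rewrite pnatr_eq0 -lt0n.
rewrite central_proj_coef sum_char_repr // mul_scalar_mx -scalemxAr mxE ffunE mulrA.
by rewrite mulrA divfK ?card_neq0 // divff // mul1r.
Qed.

Lemma central_proj_eq0 chi1 chi2 g : irr_char chi1 -> chi1 <> chi2 ->
  isotypic chi2 g -> central_proj chi1 g = 0.
Proof.
move=> [n1 [rho1 [irr1 <-]]] neq [k [a [e [coefe ->]]]]; apply/ffunP => x.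
rewrite central_proj_sum ffunE; apply: big1 => j _.
have [n [rho [v [phi [irr echi ->]]]]] := coefe j.
rewrite central_proj_coef sum_char_repr_neq // ?mul0mx ?mulmx0 ?mxE ?mulr0 //.
apply: contrapT => all_eq; apply: neq; rewrite -echi; apply/ffunP => y.
rewrite !ffunE; apply: contrapT => /eqP ne; apply: all_eq; by exists y.
Qed.

(** Substituting [y = x z^-1] gives [P_chi f x] as a multiple of the trace of
    [rho x *m M], where [M] does not depend on [x]; the diagonal entries of this
    product are matrix coefficients of [rho]. *)
Lemma isotypic_central_proj chi f : irr_char chi -> isotypic chi (central_proj chi f).
Proof.
move=> [n [rho [irr <-]]].
pose M := \sum_z f z *: rho z^-1%g.
exists n, (fun=> rep_char rho 1%g / nG).
exists (fun i => matrix_coef rho (col i M) (row i 1%:M)); split.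
  by move=> i; exists n, rho, (col i M), (row i 1%:M).
apply/ffunP => x; rewrite !ffunE -mulr_sumr; congr (_ * _).
transitivity (\tr (rho x *m M)).
  rewrite mulmx_sumr raddf_sum (reindex_inj invg_inj).
  rewrite [LHS](reindex_inj (mulIg x^-1%g)); apply: eq_bigr => z _ /=.
  rewrite -scalemxAr mxtraceZ -reprM ffunE mulrC.
  by rewrite invgK mulgKV invMg invgK.
apply: eq_bigr => i _.
rewrite ffunE row1 mulmxA -rowE mxE [RHS]mxE.
by apply: eq_bigr => j _; rewrite !mxE.
Qed.

(** The kernel [chi (x y^-1)] of [central_proj] is Hermitian, by [irr_charV]. *)
Lemma central_proj_adj chi f h : irr_char chi ->
  inner (central_proj chi f) h = inner f (central_proj chi h).
Proof.
move=> irr; congr (_ * _).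
under eq_bigr do rewrite ffunE -mulrA mulr_suml.
rewrite -mulr_sumr exchange_big /=.
under [RHS]eq_bigr => x _.
  rewrite ffunE rmorphM rmorph_sum fmorph_div /= irr_char1_conj // conjC_nat mulrCA.
  over.
rewrite /= -mulr_sumr; congr (_ * _).
under [RHS]eq_bigr do rewrite mulr_sumr.
rewrite [RHS]exchange_big [RHS](reindex_inj invg_inj); apply: eq_bigr => y _.
rewrite (reindex_inj (mulgI y)); apply: eq_bigr => x _ /=.
rewrite mulKg rmorphM.
by rewrite /= (irr_charV _ irr) conjCK invgK mulrCA mulrA.
Qed.

Lemma normsq_eq0 f : normsq f = 0 -> f = 0.
Proof.
move/eqP; rewrite mulf_eq0 invr_eq0 (negPf (card_neq0 _ _)) /= => /eqP e0.
apply/ffunP => x; rewrite ffunE; apply/eqP; rewrite -normr_eq0 -sqrf_eq0 normCK.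
apply/eqP; apply: (psumr_eq0P _ e0) => // y _.
by rewrite -normCK exprn_ge0.
Qed.

Lemma central_projB chi : {morph central_proj chi : f g / f - g}.
Proof.
move=> f g; apply/ffunP => x; rewrite !ffunE -mulrBr -sumrB; congr (_ * _).
by apply: eq_bigr => y _; rewrite !ffunE mulrBr.
Qed.

HB.instance Definition _ chi :=
  GRing.isZmodMorphism.Build _ _ (central_proj chi) (@central_projB chi).

Lemma inner_suml (I : Type) (r : seq I) (F : I -> {ffun gT -> C}) h :
  inner (\sum_(i <- r) F i) h = \sum_(i <- r) inner (F i) h.
Proof.
rewrite -mulr_sumr exchange_big; congr (_ * _); apply: eq_bigr => x _ /=.
by rewrite sum_ffunE mulr_suml.
Qed.

Lemma central_projK chi f : irr_char chi ->
  central_proj chi (central_proj chi f) = central_proj chi f.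
Proof. by move=> irr; apply: central_proj_id; apply: isotypic_central_proj. Qed.

(** Self-adjointness gives both halves: [f - P_chi f] is orthogonal to [W_chi]
    because [P_chi] kills it, and any other orthogonal projection [g] has
    [P_chi f - g = P_chi (f - g)], of squared norm
    [<f - g, P_chi (P_chi (f - g))> = 0]. *)
Lemma chi_partE chi f : irr_char chi -> chi_part chi f = central_proj chi f.
Proof.
move=> irr; apply: xget_unique => [|g [Wg orthg]].
  split=> [|h Wh]; first exact: isotypic_central_proj.
  rewrite -(central_proj_id Wh) -central_proj_adj // raddfB /= central_projK //.
  by rewrite subrr /inner big1 ?mulr0 // => x _; rewrite ffunE mul0r.
apply/esym/eqP; rewrite -subr_eq0 -(central_proj_id Wg) -raddfB.
apply/eqP/normsq_eq0; rewrite /normsq central_proj_adj //.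
by apply: orthg; apply: isotypic_central_proj.
Qed.

Lemma normsq_central_proj chi f : irr_char chi ->
  inner (central_proj chi f) f = normsq (central_proj chi f).
Proof. by move=> irr; rewrite /normsq -central_proj_adj // central_projK. Qed.

Lemma isotypic_coef n (rho : repr n) v phi : mx_irreducible rho ->
  isotypic (rep_char rho) (matrix_coef rho v phi).
Proof.
move=> irr; exists 1%N, (fun=> 1), (fun=> matrix_coef rho v phi); split.
  by move=> _; exists n, rho, v, phi.
by apply/ffunP => x; rewrite [RHS]ffunE big_ord1 mul1r.
Qed.

(** By Maschke's theorem the row space is a sum of simple submodules. Splitting
    the linear form [phi] along it splits the matrix coefficient. The index set
    and the characters are chosen before [v] and [phi], which is what makes the
    irreducible characters finite in number. *)
Lemma coef_decomposition n (rho : repr n) :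
  exists (I : finType) (chi : I -> {ffun gT -> C}),
    (forall i, irr_char (chi i)) /\
    forall v phi, exists h : I -> {ffun gT -> C},
      (forall i, isotypic (chi i) (h i)) /\ matrix_coef rho v phi = \sum_i h i.
Proof.
have Gpchar : ([pchar C]^'.-group [set: gT])%g.
  by rewrite /pgroup pcharf'_nat cardsT card_neq0.
have ss := mx_reducible_semisimple (mxmodule1 rho) (mx_Maschke_pchar rho Gpchar).
(* The semisimplicity lemma eliminates only into booleans, hence the passage
   through a classical decision of the goal. *)
apply/asboolP; apply: ss => -[I U W simU defW _]; apply/asboolP.
pose rU i := submod_repr (mxsimple_module (simU i)).
have irrU i : mx_irreducible (rU i) by apply/submod_mx_irr.
exists I, (fun i => rep_char (rU i)); split=> [i|v phi].
  by exists (\rank (U i)), (rU i).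
have : (phi <= W)%MS by rewrite defW submx1.
case/sub_sumsmxP => u ->.
pose p i := in_submod (U i) (u i *m U i).
exists (fun i => matrix_coef (rU i) (val_submod 1%:M *m v) (p i)); split=> [i|].
  exact: isotypic_coef.
apply/ffunP => x; rewrite sum_ffunE !ffunE mulmx_suml summxE.
apply: eq_bigr => i _; rewrite ffunE.
have pE : p i *m rU i x *m val_submod 1%:M = u i *m U i *m rho x.
  by rewrite -val_submodE val_submodJ ?inE // in_submodK // submxMl.
by rewrite mulmxA -pE -(mulmxA (p i *m _)) -(mulmxA (p i)).
Qed.

(** Every function is a matrix coefficient of the regular representation: let
    the form read the coordinate of the unit and let the vector list the values
    of [f]. *)
Lemma isotypic_decomposition :
  exists (I : finType) (chi : I -> {ffun gT -> C}),
    (forall i, irr_char (chi i)) /\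
    forall f, exists h : I -> {ffun gT -> C},
      (forall i, isotypic (chi i) (h i)) /\ f = \sum_i h i.
Proof.
pose reg := regular_repr C [set: gT]%G.
have [I [chi [irr dec]]] := coef_decomposition reg.
exists I, chi; split=> // f.
have [h [isoh defh]] :=
  dec (\col_i f (enum_val i)) (delta_mx 0 (gring_index [set: gT]%G 1%g)).
exists h; split=> //; rewrite -defh; apply/ffunP => x.
rewrite ffunE mulmxA -rowE rowK -rowE !mxE.
by rewrite !gring_indexK ?inE // mul1g.
Qed.

(** A character outside the finite list produced by [isotypic_decomposition]
    would have a projection that vanishes on every function; but its value at
    the unit on the indicator function of the unit is [chi(1)^2 / |G|]. *)
Lemma irr_char_complete : exists r : seq {ffun gT -> C},
  [/\ uniq r, @irr_char R gT = [set` r]%classic &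
      forall f, f = \sum_(chi <- r) central_proj chi f].
Proof.
have [I [chi [irr dec]]] := isotypic_decomposition.
pose r := undup [seq chi i | i <- enum I].
have chi_r i : chi i \in r.
  by rewrite mem_undup; apply: map_f; rewrite mem_enum.
have r_irr c : c \in r -> irr_char c.
  by rewrite mem_undup => /mapP[i _ ->].
exists r; split=> [||f].
- exact: undup_uniq.
- apply/seteqP; split=> c /=; last exact: r_irr.
  move=> irrc; apply: contrapT => cr.
  have [h [isoh defh]] := dec [ffun x => (x == 1%g)%:R].
  have : central_proj c [ffun x => (x == 1%g)%:R] = 0.
    rewrite defh raddf_sum; apply: big1 => i _.
    by apply: central_proj_eq0 (isoh i) => // cE; apply: cr; rewrite cE.
  move/ffunP/(_ 1%g)/eqP; rewrite !ffunE (bigD1 1%g) //= big1 ?addr0 => [|y y1].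
    rewrite ffunE mulg1 invg1 eqxx mulr1 !mulf_eq0 invr_eq0.
    by rewrite (negPf (card_neq0 _ _)) (negPf (irr_char1 irrc)).
  by rewrite ffunE mulg1 invg_eq1 (negPf y1) mulr0.
have [h [isoh defh]] := dec f.
transitivity (\sum_(c <- r) \sum_i central_proj c (h i)); last first.
  by apply: eq_bigr => c _; rewrite defh raddf_sum.
rewrite exchange_big defh; apply: eq_bigr => i _ /=.
rewrite (bigD1_seq (chi i)) ?undup_uniq //= (central_proj_id (isoh i)).
rewrite big_seq_cond big1 ?addr0 // => c /andP[/r_irr irrc /eqP ne].
exact: (central_proj_eq0 irrc ne (isoh i)).
Qed.

Lemma parseval r f :
  (forall chi, chi \in r -> irr_char chi) ->
  f = \sum_(chi <- r) central_proj chi f ->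
  normsq f = \sum_(chi <- r) normsq (central_proj chi f).
Proof.
move=> irr ef; rewrite /normsq {1}ef inner_suml.
by apply: eq_big_seq => chi /irr irrc; apply: normsq_central_proj.
Qed.

(** Convolution with a class function is central. *)
Lemma central_proj_conv chi f g : irr_char chi ->
  central_proj chi (conv f g) = conv f (central_proj chi g).
Proof.
move=> irr; apply/ffunP => x; rewrite !ffunE.
under eq_bigr do rewrite ffunE mulrCA mulr_sumr.
under [in RHS]eq_bigr do rewrite ffunE mulrCA.
rewrite -!mulr_sumr mulrCA; congr (_ * (_ * _)).
rewrite exchange_big; apply: eq_bigr => z _.
rewrite mulr_sumr [RHS](reindex_inj (conjg_inj z)); apply: eq_bigr => y _ /=.
rewrite mulrCA; congr (_ * (_ * _)).
  by rewrite conjgE irr_charC // mulgK.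
by rewrite conjgE !invMg invgK !mulgA mulgK.
Qed.

(** On a matrix coefficient of [rho] this is Schur's lemma for the sum of
    [rho (y^-1 w y)]. *)
Lemma sum_isotypic_conj chi g w x : isotypic chi g ->
  \sum_y g (y^-1 * w * y * x)%g = nG * chi w / chi 1%g * g x.
Proof.
move=> [k [a [e [coefe ->]]]].
under eq_bigr do rewrite ffunE.
rewrite ffunE exchange_big mulr_sumr; apply: eq_bigr => j _ /=.
have [n [rho [v [phi [irr <- ->]]]]] := coefe j.
rewrite -mulr_sumr mulrCA; congr (_ * _).
rewrite !ffunE repr_mx1 mxtrace1.
have := mulmx_coef_sum phi (rho x *m v) (fun=> 1) (fun y => rho (y^-1 * w * y)%g).
under eq_bigr do rewrite scale1r.
rewrite sum_repr_conj // mul_scalar_mx -scalemxAr mxE => ->.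
by apply: eq_bigr => y _; rewrite ffunE mul1r reprM !mulmxA.
Qed.

Lemma sum_char_translate chi f s : irr_char chi ->
  \sum_w chi w * ((f (w * s)%g)^*)%R =
  nG / chi 1%g * ((central_proj chi f s)^*)%R.
Proof.
move=> irr; rewrite ffunE rmorphM fmorph_div /= irr_char1_conj // conjC_nat.
rewrite mulrA mulrA divfK ?irr_char1 // divff ?card_neq0 // mul1r.
rewrite rmorph_sum (reindex_inj invg_inj); apply: eq_bigr => w _.
by rewrite rmorphM /= (irr_charV _ irr).
Qed.

(** The case of a single convolution, where all the group averaging happens. *)
Lemma expectation_conv chi f g : irr_char chi -> isotypic chi g ->
  expectation (fun s => normsq (conv (translate s f) g)) =
  normsq (central_proj chi f) * normsq g / chi 1%g ^+ 2.
Proof.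
move=> irr isog.
pose T := \sum_(s : gT) \sum_x (\sum_y f (y * s)%g * g (y^-1 * x)%g) *
  ((\sum_y f (y * s)%g * g (y^-1 * x)%g)^*)%R.
have -> : expectation (fun s => normsq (conv (translate s f) g)) = T / nG ^+ 4.
  rewrite /expectation; under eq_bigr do rewrite /normsq /inner.
  rewrite -mulr_sumr mulrA /T.
  rewrite (eq_bigr (fun s : gT => nG ^- 2 *
     \sum_x (\sum_y f (y * s)%g * g (y^-1 * x)%g) *
     ((\sum_y f (y * s)%g * g (y^-1 * x)%g)^*)%R)).
    rewrite -mulr_sumr; have := card_neq0 C gT; move: nG => N N0.
    by rewrite mulrA mulrC; congr (_ * _); field.
  move=> s _; rewrite mulr_sumr; apply: eq_bigr => x _.
  rewrite ffunE rmorphM fmorphV /= conjC_nat mulrACA -expr2 exprVn.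
  by under eq_bigr do rewrite ffunE.
suff -> : T = nG ^+ 4 / chi 1%g ^+ 2 * (normsq (central_proj chi f) * normsq g).
  have := card_neq0 C gT; have := irr_char1 irr; move: nG (chi 1%g) => N d d0 N0.
  by field; rewrite ?N0 ?d0.
pose A w := \sum_s f s * ((f (w * s)%g)^*)%R.
(* The convolution variables are [y] and [z = w y]. Then [s] is replaced by
   [y^-1 s] and [x] by [w y x], which leaves the [f]-factors without [y]. *)
have -> : T = \sum_w A w * \sum_x (\sum_y g (y^-1 * w * y * x)%g) * ((g x)^*)%R.
  transitivity (\sum_w \sum_y \sum_s \sum_x
      (f (y * s)%g * g (y^-1 * x)%g) *
      ((f (w * y * s)%g * g ((w * y)^-1 * x)%g)^*)%R).
    rewrite exchange_big /=.
    rewrite [RHS](eq_bigr (fun y => \sum_s \sum_x \sum_z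
      (f (y * s)%g * g (y^-1 * x)%g) *
      ((f (z * s)%g * g (z^-1 * x)%g)^*)%R)) => [|y _]; last first.
      rewrite exchange_big; apply: eq_bigr => s _.
      rewrite exchange_big; apply: eq_bigr => x _ /=.
      by rewrite [RHS](reindex_inj (mulIg y)).
    rewrite exchange_big; apply: eq_bigr => s _.
    rewrite exchange_big; apply: eq_bigr => x _ /=.
    by rewrite mulr_suml; apply: eq_bigr => y _; rewrite rmorph_sum mulr_sumr.
  apply: eq_bigr => w _; rewrite mulr_suml.
  under eq_bigr => y _.
    rewrite (reindex_inj (mulgI y^-1%g)).
    under eq_bigr do rewrite (reindex_inj (mulgI (w * y)%g)).
    over.
  rewrite exchange_big; apply: eq_bigr => s _.
  rewrite exchange_big mulr_sumr; apply: eq_bigr => x _ /=.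
  rewrite mulr_suml mulr_sumr; apply: eq_bigr => y _.
  rewrite mulKVg mulKg -(mulgA w y (y^-1 * s)%g) mulKVg rmorphM /= !mulgA.
  exact: mulrACA.
under eq_bigr => w _.
  under eq_bigr do rewrite (sum_isotypic_conj _ _ isog) -mulrA.
  rewrite -mulr_sumr mulrA.
  over.
rewrite -mulr_suml.
have -> : \sum_x g x * ((g x)^*)%R = nG * normsq g.
  by rewrite mulVKf ?card_neq0.
have -> : \sum_w A w * (nG * chi w / chi 1%g) =
    nG ^+ 3 / chi 1%g ^+ 2 * normsq (central_proj chi f).
  transitivity (nG / chi 1%g * \sum_s f s * \sum_w chi w * ((f (w * s)%g)^*)%R).
    under [in RHS]eq_bigr do rewrite mulr_sumr.
    rewrite [in RHS]exchange_big mulr_sumr; apply: eq_bigr => w _ /=.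
    rewrite mulr_suml mulr_sumr; apply: eq_bigr => s _.
    by rewrite mulrAC !mulrA; ring.
  under eq_bigr do rewrite (sum_char_translate _ _ irr) mulrCA.
  rewrite -mulr_sumr.
  have -> : \sum_s f s * ((central_proj chi f s)^*)%R = nG * normsq (central_proj chi f).
    by rewrite -normsq_central_proj // central_proj_adj // mulVKf ?card_neq0.
  by have := irr_char1 irr; move: nG (chi 1%g) => N d d0; field.
ring.
Qed.

End Isotypic.

(** * Iterated convolutions *)

Section Twisted.
Variables (R : realType) (gT : finGroupType).
Local Notation C := R[i].

Lemma expectation_cons m (F : {ffun 'I_m.+1 -> gT} -> C) :
  expectation F = expectation (fun t : {ffun 'I_m -> gT} =>
    expectation (fun s0 : gT =>
      F [ffun i => if unlift ord0 i is Some j then t j else s0])).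
Proof.
rewrite /expectation -mulr_sumr mulrA; congr (_ * _).
  by rewrite -invfM -natrM !card_ffun !card_ord expnSr.
rewrite pair_big /=.
rewrite (reindex (fun p : {ffun 'I_m -> gT} * gT =>
   [ffun i => if unlift ord0 i is Some j then p.1 j else p.2])) //=.
exists (fun s : {ffun 'I_m.+1 -> gT} => ([ffun j => s (lift ord0 j)], s ord0)).
  move=> [t s0] _ /=; rewrite ffunE unlift_none; congr (_, _).
  by apply/ffunP => j; rewrite !ffunE liftK.
move=> s _; apply/ffunP => i; rewrite ffunE /=.
by case: unliftP => [j|] ->; rewrite ?ffunE.
Qed.

Lemma twisted_conv_cons m (f : 'I_m.+2 -> {ffun gT -> C})
    (t : {ffun 'I_m -> gT}) s0 :
  twisted_conv f [ffun i => if unlift ord0 i is Some j then t j else s0] =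
  conv (translate s0 (f ord0)) (twisted_conv (fun i => f (lift ord0 i)) t).
Proof.
rewrite /twisted_conv enum_ordSl /= ffunE unlift_none.
rewrite (_ : widen_ord _ ord0 = ord0); last exact: ord_inj.
rewrite (_ : lift ord0 ord_max = ord_max); last exact: ord_inj.
rewrite -map_comp; congr (conv _ (foldr _ _ _)).
apply: eq_map => j /=; rewrite ffunE liftK; congr (translate _ (f _)).
exact: ord_inj.
Qed.

Lemma expectation_twisted_proj chi m (f : 'I_m.+1 -> {ffun gT -> C}) :
  irr_char chi ->
  expectation (fun s : {ffun 'I_m -> gT} =>
    normsq (central_proj chi (twisted_conv f s))) =
  (\prod_(i < m.+1) normsq (central_proj chi (f i))) / chi 1%g ^+ (2 * m).
Proof.
move=> irr; elim: m f => [|m IHm] f.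
  rewrite /expectation /twisted_conv big_ord1 muln0 expr0 divr1.
  rewrite (_ : enum 'I_0 = [::]) /=; last by apply/size0nil; rewrite size_enum_ord.
  rewrite sumr_const card_ffun card_ord expn0 invr1 mul1r.
  by rewrite (_ : ord0 = ord_max) //; apply: ord_inj.
rewrite expectation_cons /expectation.
under eq_bigr => t _.
  under eq_bigr do rewrite twisted_conv_cons central_proj_conv //.
  rewrite -[_ * _]/(expectation _) (expectation_conv _ irr);
    last exact: isotypic_central_proj.
  rewrite mulrAC.
  over.
rewrite -mulr_sumr mulrCA -[X in _ * X]/(expectation _) IHm.
by rewrite [in RHS]big_ord_recl mulnS exprD [in RHS]invfM [RHS]mulrACA.
Qed.

End Twisted.

(* The sum on the right ranges over the (finite) set of irreducible complex
   characters of G. *)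
Theorem lemma4p3 (R : realType) (gT : finGroupType) (m : nat) (hm : (1 <= m)%N)
    (f : 'I_m.+1 -> {ffun gT -> R[i]}) :
  expectation (fun s : {ffun 'I_m -> gT} => normsq (twisted_conv f s)) =
  \sum_(chi \in @irr_char R gT)
    (\prod_(i < m.+1) normsq (chi_part chi (f i))) / chi 1%g ^+ (2 * m).
Proof.
have [r [Ur rE complete]] := irr_char_complete R gT.
have r_irr chi : chi \in r -> irr_char chi by rewrite rE.
rewrite rE -fsbig_seq // /expectation.
under [in LHS]eq_bigr do rewrite (parseval r_irr (complete _)).
rewrite exchange_big mulr_sumr; apply: eq_big_seq => chi /r_irr irr.
rewrite -[LHS]/(expectation _) expectation_twisted_proj //.
by congr (_ / _); apply: eq_bigr => i _; rewrite chi_partE.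
Qed.
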